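(* There exists a function $b:[0,1]\to\mathbb{R}_+$ such that $$\mathcal{C}=\{(t,x)\in[0,1)\times\mathbb{R}\,:\,x<b(t)\}.$$
   Context: Let $(\Omega,\mathcal{F},(\mathcal{F}_t)_{t\ge 0},\mathsf{P})$ be a complete filtered probability space carrying a standard one-dimensional Brownian motion $W=(W_t)_{t\ge0}$, where $(\mathcal{F}_t)$ is the filtration generated by $W$ augmented with $\mathsf{P}$-null sets. For $t\in[0,1)$ and $x\in\mathbb{R}$, let $X^{t,x}=(X^{t,x}_s)_{s\in[t,1]}$ be the Brownian bridge started at $x$ at time $t$ and pinned at $0$ at time $1$: $$X^{t,x}_s=(1-s)\Big(\frac{x}{1-t}+\int_t^s\frac{\mathrm{d}W_u}{1-u}\Big),\quad s\in[t,1),\qquad X^{t,x}_1=0,$$ i.e. the strong solution of $\mathrm{d}X_s=-\frac{X_s}{1-s}\,\mathrm{d}s+\mathrm{d}W_s$, $s\in[t,1)$, $X_t=x$. Write $\mathsf{E}_{t,x}[\,\cdot\,]=\mathsf{E}[\,\cdot\,|X_t=x]$. The value function is $$v(t,x)=\sup_{0\le\tau\le1-t}\mathsf{E}_{t,x}\big[e^{X_{t+\tau}}\big],\qquad (t,x)\in[0,1]\times\mathbb{R},$$ where the supremum is over random times $\tau\in[0,1-t]$ such that $t+\tau$ is an $(\mathcal{F}_s)_{s\ge t}$-stopping time; in particular $v(1,x)=e^x$. The continuation region is $\mathcal{C}:=\{(t,x)\in[0,1]\times\mathbb{R}:v(t,x)>e^x\}$, and $\mathbb{R}_+=[0,\infty)$.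 *)

(* Defs.v *)
From HB Require Import structures.
From mathcomp Require Import all_boot all_order all_algebra.
From mathcomp Require Import all_classical all_reals all_analysis.

Set Implicit Arguments.
Unset Strict Implicit.
Unset Printing Implicit Defensive.

Import Order.TTheory GRing.Theory Num.Theory.
Import numFieldNormedType.Exports.
Local Open Scope classical_set_scope.
Local Open Scope ring_scope.

(* Processes have type R -> T -> R, with real time as first argument; only
   their values on the relevant time interval matter. *)

Section Defs.
Context (d : measure_display) (T : measurableType d) (R : realType).
Variable P : probability T R.

Definition increment (W : R -> T -> R) (s t : R) (w : T) : R :=
  W t w - W s w.

Definition past_events (W : R -> T -> R) (t : R) : set (set T) :=
  [set A | exists s (B : set R),
     [/\ 0 <= s <= t, measurable B & A = W s @^-1` B]].

Definition natural_filtration (W : R -> T -> R) (t : R) : set (set T) :=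
  <<s past_events W t >>.

Definition augmented_filtration (W : R -> T -> R) (t : R) : set (set T) :=
  <<s past_events W t `|` P.-negligible >>.

(* The second parameter of normal_prob is the standard deviation. *)
Definition standard_brownian_motion (W : R -> T -> R) : Prop :=
  [/\ forall t, 0 <= t -> measurable_fun setT (W t),
      {ae P, forall w, W 0 w = 0},
      {ae P, forall w, {within `[0, +oo[, continuous (W ^~ w)}},
      forall s t, 0 <= s < t -> forall B : set R, measurable B ->
        P (increment W s t @^-1` B) =
        normal_prob 0 (Num.sqrt (t - s)) B &
      forall s t, 0 <= s < t -> forall (A : set T) (B : set R),
        natural_filtration W s A -> measurable B ->
        P (A `&` increment W s t @^-1` B) =
        (P A * P (increment W s t @^-1` B))%E].

(* The list of all (c, (p, q)) encodes the step function
   \sum c * 1_(]p, q]); the intervals may overlap. *)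
Definition step_fun (phi : seq (R * (R * R))) (u : R) : R :=
  \sum_(i <- phi) i.1 * \1_(`]i.2.1, i.2.2]) u.

Definition step_integral (W : R -> T -> R) (phi : seq (R * (R * R))) (w : T)
    : R :=
  \sum_(i <- phi) i.1 * (W i.2.2 w - W i.2.1 w).

Definition step_on (a b : R) (phi : seq (R * (R * R))) : bool :=
  all (fun i : R * (R * R) =>
    [&& a <= i.2.1, i.2.1 <= i.2.2 & i.2.2 <= b]) phi.

(* I is the stochastic integral over [a, b] of the deterministic function
   f \in L^2([a, b]) against W: the L^2(P)-limit of the integrals of step
   functions converging to f in L^2([a, b]).  Step functions being dense, such
   approximations exist, and the limit does not depend on the one chosen. *)
Definition wiener_integral (W : R -> T -> R) (f : R -> R) (a b : R)
    (I : T -> R) : Prop :=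
  measurable_fun setT I /\
  forall phi : nat -> seq (R * (R * R)),
    (forall n, step_on a b (phi n)) ->
    (\int[lebesgue_measure]_(u in `[a, b])
        ((step_fun (phi n) u - f u) ^+ 2)%R%:E)%E @[n --> \oo] --> 0%E ->
    'E_P[fun w => ((step_integral W (phi n) w - I w) ^+ 2)%R]%E @[n --> \oo] -->
      0%E.

(* Continuity is only required on [t, 1[: almost sure continuity at time 1 is
   a consequence of the other conditions. *)
Definition brownian_bridge (W : R -> T -> R) (t x : R) (X : R -> T -> R)
    : Prop :=
  [/\ forall s, t <= s <= 1 -> forall B : set R, measurable B ->
        augmented_filtration W s (X s @^-1` B),
      {ae P, forall w, {within `[t, 1[, continuous (X ^~ w)}},
      forall s, t <= s < 1 -> exists2 I : T -> R,
        wiener_integral W (fun u => (1 - u)^-1) t s I &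
        {ae P, forall w, X s w = (1 - s) * (x / (1 - t) + I w)} &
      {ae P, forall w, X 1 w = 0}].

Definition admissible_time (W : R -> T -> R) (t : R) (tau : T -> R) : Prop :=
  (forall w, 0 <= tau w <= 1 - t) /\
  forall s, t <= s -> augmented_filtration W s [set w | t + tau w <= s].

(* X t x is the bridge started at x at time t.  At t = 1 the bridge formula
   makes no sense; there X_1 = x and the only admissible time is 0. *)
Definition value (W : R -> T -> R) (X : R -> R -> R -> T -> R) (t x : R)
    : \bar R :=
  if t < 1 then
    ereal_sup [set 'E_P[fun w => expR (X t x (t + tau w)%R w)]%E
              | tau in admissible_time W t]
  else (expR x)%:E.

Definition continuation_region (W : R -> T -> R) (X : R -> R -> R -> T -> R)
    : set (R * R) :=
  [set z | 0 <= z.1 <= 1 /\ ((expR z.2)%:E < value W X z.1 z.2)%E].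

End Defs.

(* Main.v *)
Require Import Defs.
From HB Require Import structures.
From mathcomp Require Import all_boot all_order all_algebra.
From mathcomp Require Import all_classical all_reals all_analysis.
From mathcomp Require Import measurable_realfun.
From mathcomp Require Import lra ring.
Set Implicit Arguments.
Unset Strict Implicit.
Unset Printing Implicit Defensive.
Import Order.TTheory GRing.Theory Num.Theory.
Import numFieldNormedType.Exports.
Local Open Scope classical_set_scope.
Local Open Scope ring_scope.

(** Fix [t < 1] and put [L = 1 - t].  Let [S] be the set of all [x] such that
    immediate stopping at [(t, x)] is not optimal.  The claim is that [S] is an
    open left half-line with nonnegative end point, and [b t] is that end point.

    Bridges from two starting points are driven by the same stochastic integral,
    so almost surely [X^y_s = X^x_s + (y - x) (1 - s) / L] for all [s] between
    [t] and [1] ([bridge_shift]).  As [(1 - s) / L] is between [0] and [1], for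
    any fixed stopping time lowering the starting point from [x] to [y]
    multiplies the payoff by at least [exp (y - x)] ([stopped_bridge_down]), so
    [S] is downward closed; and raising the starting point does not lower the payoff
    ([stopped_bridge_up]), so a strict inequality at [x] persists slightly to the
    right of [x].  Waiting until time [1] pays [1], so [S] contains every [x < 0].

    The substance is that [S] is bounded above: immediate stopping is optimal at
    [x = L + 1] ([stopped_bridge_bound]).  Write [M_s] for the integral of
    [1 / (1 - u)] against [W] from [t] to [s]; its variance is
    [q_s = 1 / (1 - s) - 1 / L].  The positive martingale
    [N_s = exp (2 L M_s - 2 L^2 q_s)] starts at [1], and for [x = L + 1] one has
    the pointwise domination [exp (X_s) <= exp x * (1 + N_s) / 2]: setting
    [N_s = exp (2 y)] it reduces to
    [exp (rho (y + 1) - 1) <= (1 + exp (2 y)) / 2] for [rho = (1 - s) / L]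
    ([expR_interpolation_le]).  Optional stopping gives [E N_tau <= 1] on
    [tau < L], and on [tau = L] the payoff is [1 <= exp x / 2].

    Optional stopping is obtained by two passages to the limit.  For a stopping
    time with values in a fixed grid, [M] is the L^2 limit of integrals of step
    functions along finer and finer grids, and the exponential martingale of such
    a step function is stopped in discrete time
    ([discrete_optional_stopping], [exp_martingale_stopped]).  Capping the
    exponent at a constant makes the exponential Lipschitz, so L^2 convergence is
    enough to pass to the limit ([stopped_exponential_le1]).  A general stopping
    time is then rounded up to finer and finer grids; path continuity and Fatou's lemma
    finish, the cap being removed along the way. *)

(** * Inequalities for the exponential *)

Section exponential_inequalities.
Context (R : realType).
Implicit Types a b c y rho : R.

Lemma expRN1_le_half : expR (- 1) <= 2^-1 :> R.
Proof.
rewrite expRN lef_pV2 ?posrE ?expR_gt0//.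
by apply: le_trans (expR_ge1Dx 1); lra.
Qed.

(** For [y >= -1] the left side is at most [exp y], its value at [rho = 1], and
    the geometric mean [exp y] of [1] and [exp (2 y)] is below their arithmetic
    mean.  For [y < -1] it is at most its value [exp (-1)] at [rho = 0]. *)
Lemma expR_interpolation_le rho y : 0 <= rho <= 1 ->
  expR (rho * (y + 1) - 1) <= 2^-1 * (1 + expR (2 * y)).
Proof.
move=> /andP[r0 r1].
have -> : expR (2 * y) = expR y ^+ 2 by rewrite -expRM_natl.
have e0 := expR_gt0 y.
have [y1|y1] := leP (- 1) y.
  apply: (@le_trans _ _ (expR y)).
    by rewrite ler_expR; nra.
  by have := sqr_ge0 (expR y - 1); nra.
apply: (@le_trans _ _ (expR (- 1))).
  by rewrite ler_expR; nra.
by apply: le_trans expRN1_le_half _; nra.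
Qed.

(** The tangent line of [exp] at [min a c] has slope at most [exp c]. *)
Lemma expR_min_le a b c :
  expR (Num.min a c) <= expR b + expR c * `|a - b|.
Proof.
set m := Num.min a c.
have mc : m <= c by rewrite /m ge_min lexx orbT.
have ma : m <= a by rewrite /m ge_min lexx.
have ec : expR m <= expR c by rewrite ler_expR.
have e0 := expR_gt0 m.
have [mb|bm] := leP m b.
  rewrite -[leLHS]addr0 lerD ?ler_expR// mulr_ge0// expR_ge0.
have H : expR m * (1 + (b - m)) <= expR b.
  have -> : expR b = expR m * expR (b - m) by rewrite -expRD addrC subrK.
  by rewrite ler_pM2l//; exact: expR_ge1Dx.
have : expR m * (m - b) <= expR c * `|a - b|.
  apply: ler_pM => //.
    by rewrite subr_ge0 ltW.
  by apply: le_trans (ler_norm _); rewrite lerD2r.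
by move: H; rewrite mulrDr mulr1 !mulrBr; lra.
Qed.

End exponential_inequalities.

(** * Measures with a density, and the Gaussian moment generating function *)

Section integral_with_density.
Context d (T : measurableType d) (R : realType).
Local Open Scope ereal_scope.
Import HBNNSimple.

Lemma ge0_integral_density (mu nu : {measure set T -> \bar R})
    (p : T -> R) (f : T -> \bar R) :
  measurable_fun setT p -> (forall x, (0 <= p x)%R) ->
  (forall A, measurable A -> nu A = \int[mu]_(x in A) (p x)%:E) ->
  measurable_fun setT f -> (forall x, 0 <= f x) ->
  \int[nu]_x f x = \int[mu]_x (f x * (p x)%:E).
Proof.
move=> mp p0 nuE mf f0.
have mpE : measurable_fun setT (EFin \o p) by exact/measurable_EFinP.
pose f_ := nnsfun_approx measurableT mf.
have indicE (A : set T) : measurable A ->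
    \int[nu]_x (\1_A x)%:E = \int[mu]_x ((\1_A x)%:E * (p x)%:E).
  move=> mA; rewrite integral_indic// setIT nuE// integral_mkcond.
  apply: eq_integral => x _; rewrite patchE indicE.
  by case: (x \in A); rewrite ?mul1e ?mul0e.
have simpleE (h : {nnsfun T >-> R}) :
    \int[nu]_x (h x)%:E = \int[mu]_x ((h x)%:E * (p x)%:E).
  under [LHS]eq_integral do rewrite fimfunE -fsumEFin//.
  rewrite [LHS]ge0_integral_fsum//; last 2 first.
    - by move=> r; exact/measurable_EFinP/measurableT_comp.
    - by move=> n x _; rewrite EFinM nnfun_muleindic_ge0.
  under [RHS]eq_integral.
    move=> x xD; rewrite fimfunE -fsumEFin// muleC ge0_mule_fsumr; last first.
      by move=> r; rewrite EFinM nnfun_muleindic_ge0.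
    over.
  rewrite [RHS]ge0_integral_fsum//; last 2 first.
    - move=> r; apply: emeasurable_funM => //.
      by apply/measurable_EFinP/measurableT_comp => //.
    - move=> n x _; rewrite EFinM mule_ge0//; last by rewrite nnfun_muleindic_ge0.
      by rewrite lee_fin.
  apply: eq_fsbigr => r _.
  rewrite integralZl_indic_nnsfun//= indicE//.
  have [r0|r0] := leP 0%R r.
    rewrite -ge0_integralZl//.
    - by apply: eq_integral => x _; rewrite -!EFinM; congr EFin; ring.
    - apply: emeasurable_funM => //.
      by apply/measurable_EFinP; exact: measurable_indic.
    - by move=> x _; rewrite mule_ge0// lee_fin.
  have -> : h @^-1` [set r] = set0.
    apply/seteqP; split => // x /= hx; have : (0 <= h x)%R by exact: fun_ge0.
    by rewrite hx leNgt r0.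
  by rewrite indic0 !integral0_eq ?mule0// => x _; rewrite !(mul0e, mule0, mulr0).
transitivity (limn (fun n => \int[nu]_x (f_ n x)%:E)).
  rewrite -monotone_convergence//=.
  - apply: eq_integral => ? /[!inE] xD; apply/esym/cvg_lim => //=.
    exact: cvg_nnsfun_approx.
  - by move=> n; exact/measurable_EFinP/measurable_funTS.
  - by move=> n ? _; rewrite lee_fin.
  - by move=> ? _ ? ? mn; rewrite lee_fin; exact/lefP/nd_nnsfun_approx.
rewrite (_ : (fun n => _) =
    fun n => \int[mu]_x ((f_ n x)%:E * (p x)%:E)); last first.
  by apply/funext => n; rewrite simpleE.
rewrite -monotone_convergence//=.
- apply: eq_integral => x _; apply/cvg_lim => //.
  rewrite muleC; under eq_fun do rewrite muleC.
  by apply: cvgeZl => //; exact: cvg_nnsfun_approx.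
- move=> n; apply: emeasurable_funM => //.
  exact/measurable_EFinP/measurable_funTS.
- by move=> n ? _; rewrite mule_ge0// lee_fin.
- move=> x _ m n mn; rewrite lee_wpmul2r// ?lee_fin//.
  exact/lefP/nd_nnsfun_approx.
Qed.

End integral_with_density.

Section gaussian.
Context (R : realType).
Local Open Scope ereal_scope.

(** Completing the square turns [exp (a x)] times the centred density into
    [exp (a^2 s^2 / 2)] times the density centred at [a s^2]. *)
Lemma normal_prob_mgf (a s : R) : s != 0%R ->
  \int[normal_prob 0 s]_x (expR (a * x))%:E = (expR (a ^+ 2 * s ^+ 2 / 2))%:E.
Proof.
move=> s0.
have mexp : measurable_fun setT (fun x : R => expR (a * x)).
  by apply: measurableT_comp => //; apply: measurable_funM.
rewrite (@ge0_integral_density _ _ R lebesgue_measure _ (normal_pdf 0 s))//.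
- transitivity (\int[lebesgue_measure]_x ((expR (a ^+ 2 * s ^+ 2 / 2))%:E *
      (normal_pdf (a * s ^+ 2) s x)%:E)).
    apply: eq_integral => x _; rewrite -!EFinM; congr EFin.
    rewrite !normal_pdfE// /normal_fun !(mulrCA _ (normal_peak s)).
    congr (_ * _)%R; rewrite -!expRD; congr expR.
    by field.
  rewrite ge0_integralZl_EFin ?integral_normal_pdf ?mule1 ?expR_ge0//.
  + by move=> x _; rewrite lee_fin normal_pdf_ge0.
  + by apply/measurable_EFinP; exact: measurable_normal_pdf.
- exact: measurable_normal_pdf.
- by move=> x; exact: normal_pdf_ge0.
- by apply/measurable_EFinP.
Qed.

End gaussian.

(** * Independent random variables *)

Section independence.
Context d (T : measurableType d) (R : realType) (P : probability T R).
Local Open Scope ereal_scope.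

(** The product rule on rectangles says that the joint law of [f] and [g] is the
    product of their laws, so the claim is Tonelli's theorem. *)
Lemma integralM_indep (f g : T -> R) (h : R -> R) :
  measurable_fun setT f -> measurable_fun setT g -> measurable_fun setT h ->
  (forall w, (0 <= f w)%R) -> (forall y, (0 <= h y)%R) ->
  (forall A B : set R, measurable A -> measurable B ->
    P (f @^-1` A `&` g @^-1` B) = P (f @^-1` A) * P (g @^-1` B)) ->
  \int[P]_w (f w * h (g w))%:E = \int[P]_w (f w)%:E * \int[P]_w (h (g w))%:E.
Proof.
move=> mf mg mh f0 h0 fg.
pose F : {mfun T >-> R} := HB.pack f (isMeasurableFun.Build _ _ _ _ _ mf).
pose G : {mfun T >-> R} := HB.pack g (isMeasurableFun.Build _ _ _ _ _ mg).
have mfg : measurable_fun setT (fun w => (f w, g w)).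
  exact: measurable_fun_pair.
pose FG : {mfun T >-> (R * R)%type} :=
  HB.pack (fun w => (f w, g w)) (isMeasurableFun.Build _ _ _ _ _ mfg).
have law := @product_measure_unique _ _ _ _ R (distribution P F)
  (distribution P G) (distribution P FG) fg.
(* Taking a positive part makes the integrand nonnegative off the range of f. *)
pose k (z : R * R) := ((Num.max z.1 0) * h z.2)%:E.
have mk : measurable_fun setT k.
  apply/measurable_EFinP; apply: measurable_funM.
    by apply: measurable_maxr => //; exact: measurable_fst.
  by apply: measurableT_comp => //; exact: measurable_snd.
have k0 z : 0 <= k z by rewrite lee_fin mulr_ge0// le_max lexx orbT.
transitivity (\int[distribution P FG]_z k z).
  rewrite ge0_integral_distribution//; apply: eq_integral => w _ /=.
  by rewrite /k /= max_l.
rewrite (@eq_measure_integral _ _ _ _ (distribution P F \x distribution P G)%E);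
  last by move=> A mA _; rewrite -law.
rewrite fubini_tonelli1//.
transitivity (\int[distribution P F]_x ((Num.max x 0)%:E * \int[P]_w (h (g w))%:E)).
  apply: eq_integral => x _; rewrite /fubini_F/=.
  under eq_integral do rewrite /k /= EFinM.
  rewrite ge0_integralZl_EFin//=.
  - by rewrite ge0_integral_distribution//; exact/measurable_EFinP.
  - by move=> y _; rewrite lee_fin.
  - exact/measurable_EFinP.
  - by rewrite le_max lexx orbT.
have mmax : measurable_fun setT (fun x : R => (Num.max x 0)%:E).
  by apply/measurable_EFinP; exact: measurable_maxr.
rewrite ge0_integralZr//; last 2 first.
  - by move=> x _; rewrite lee_fin le_max lexx orbT.
  - by apply: integral_ge0 => w _; rewrite lee_fin.
congr (_ * _); rewrite ge0_integral_distribution//; last first.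
  by move=> x; rewrite lee_fin le_max lexx orbT.
by apply: eq_integral => w _ /=; rewrite max_l.
Qed.

End independence.

(** * Optional stopping in discrete time *)

Section optional_stopping.
Context d (T : measurableType d) (R : realType).
Variable mu : {measure set T -> \bar R}.
Local Open Scope ereal_scope.

(** Here [E k] plays the role of the event [tau <= k], so [seqD E k] is
    [tau = k]; the supermartingale property is only needed on the events
    [tau > k].  The mass of [Y] stopped at [tau] up to time [k], plus the mass of
    [Y k] on [tau > k], is nonincreasing in [k]. *)
Lemma discrete_optional_stopping (E : nat -> set T) (Y : nat -> T -> \bar R) K :
  (forall k, measurable (E k)) -> (forall k, E k `<=` E k.+1) ->
  (forall k, measurable_fun setT (Y k)) -> (forall k w, 0 <= Y k w) ->
  (forall k, \int[mu]_(w in ~` E k) Y k.+1 w <= \int[mu]_(w in ~` E k) Y k w) ->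
  \sum_(0 <= k < K) \int[mu]_(w in seqD E k) Y k w
    <= \int[mu]_w Y 0%N w.
Proof.
move=> mE ndE mY Y0 super.
have mYA k A : measurable A -> measurable_fun A (Y k).
  by move=> mA; apply: measurable_funTS.
have split_integral k (A B : set T) : measurable A -> measurable B ->
    A `&` B = set0 ->
    \int[mu]_(w in A `|` B) Y k w =
    \int[mu]_(w in A) Y k w + \int[mu]_(w in B) Y k w.
  move=> mA mB AB; rewrite ge0_integral_setU//.
    by apply: mYA; exact: measurableU.
  by rewrite disj_set2E; exact/eqP.
have inv k : \sum_(0 <= i < k.+1) \int[mu]_(w in seqD E i) Y i w
    + \int[mu]_(w in ~` E k) Y k w <= \int[mu]_w Y 0%N w.
  elim: k => [|k ih].
    rewrite big_nat1 /= -split_integral ?setUCr//.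
    - exact: measurableC.
    - exact: setICr.
  apply: le_trans ih; rewrite big_nat_recr//= -addeA leeD2l//.
  apply: le_trans (super k).
  rewrite -split_integral.
  - rewrite (_ : _ `|` _ = ~` E k)//; apply/seteqP; split => w /=.
      by case=> [[]//|nEk1 Ek]; apply: nEk1; exact: ndE.
    by move=> nEk; have [Ek1|nEk1] := pselect (E k.+1 w); [left|right].
  - exact: measurableD.
  - exact: measurableC.
  - by apply/seteqP; split => // w [[]].
case: K => [|K]; first by rewrite big_geq// integral_ge0.
by apply: le_trans (inv K); rewrite leeDl// integral_ge0.
Qed.

End optional_stopping.

(** * The augmented filtration *)

Section brownian_filtration.
Context d (T : measurableType d) (R : realType) (P : probability T R).
Variable W : R -> T -> R.
Hypothesis complete_P : measure_is_complete P.
Hypothesis brownian_W : standard_brownian_motion P W.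
Local Open Scope ereal_scope.

Lemma past_events_measurable s A : past_events W s A -> measurable A.
Proof.
case: brownian_W => mW _ _ _ _ [r [B [/andP[r0 rs] mB ->]]].
by rewrite -[X in measurable X]setTI; exact: mW.
Qed.

Lemma natural_filtration_measurable s A : natural_filtration W s A ->
  measurable A.
Proof.
apply: (@smallest_sub _ (sigma_algebra setT) _ (@measurable _ T)).
  exact: sigma_algebra_measurable.
exact: past_events_measurable.
Qed.

Lemma augmented_filtration_measurable s A : augmented_filtration P W s A ->
  measurable A.
Proof.
apply: (@smallest_sub _ (sigma_algebra setT) _ (@measurable _ T)).
  exact: sigma_algebra_measurable.
by move=> B [/past_events_measurable//|/complete_P].
Qed.

Lemma augmented_filtrationS s t : (s <= t)%R ->
  augmented_filtration P W s `<=` augmented_filtration P W t.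
Proof.
move=> st; apply: sub_sigma_algebra2; apply: setUSS => // A.
move=> [r [B [/andP[r0 rs] mB ->]]].
by exists r, B; split => //; rewrite r0 (le_trans rs).
Qed.

(** The sets that agree with an event of the natural filtration up to a
    negligible set form a sigma-algebra containing all generators. *)
Lemma augmented_filtration_natural s A : augmented_filtration P W s A ->
  exists2 A', natural_filtration W s A' &
    P.-negligible ((A `\` A') `|` (A' `\` A)).
Proof.
pose G := [set A | exists2 A', natural_filtration W s A' &
    P.-negligible ((A `\` A') `|` (A' `\` A))].
apply: (@smallest_sub _ (sigma_algebra setT) _ G); last first.
  move=> B [pB|nB].
    exists B; first exact: sub_gen_smallest.
    by rewrite setDv setU0; exact: negligible_set0.
  exists set0; first by have [] := smallest_sigma_algebra setT (past_events W s).
  by rewrite setD0 set0D setU0.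
have [n0 nC nU] := @smallest_sigma_algebra _ setT (past_events W s).
split.
- by exists set0 => //; rewrite setDv setU0; exact: negligible_set0.
- move=> B [B' nB' BB']; exists (setT `\` B'); first exact: nC.
  apply: negligibleS BB' => w /=.
  move=> [[[_ nB]]|[[_ nB]]] h.
    by right; split => //; apply: contrapT => h'; apply: h.
  by left; split => //; apply: contrapT => h'; apply: h.
- move=> F FG; have [F' F'E] := choice (fun i =>
    let: ex_intro2 x a b := FG i in ex_intro _ x (conj a b)).
  exists (\bigcup_i F' i); first by apply: nU => i; have [] := F'E i.
  apply: (@negligibleS _ _ _ _
    (\bigcup_i ((F i `\` F' i) `|` (F' i `\` F i))) _).
    move=> w [[[i _ Fi] nF']|[[i _ Fi] nF']]; exists i => //.
      by left; split => // h; apply: nF'; exists i.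
    by right; split => // h; apply: nF'; exists i.
  by apply: negligible_bigcup => i; have [] := F'E i.
Qed.

(** Modifying an event by a negligible set does not change the probabilities in
    the product rule, so independence of the increments extends from the natural
    to the augmented filtration. *)
Lemma increment_indep s t (A : set T) (B : set R) : (0 <= s < t)%R ->
  augmented_filtration P W s A -> measurable B ->
  P (A `&` increment W s t @^-1` B) = P A * P (increment W s t @^-1` B).
Proof.
move=> st FA mB.
have [A' nA' AA'] := augmented_filtration_natural FA.
have mA := augmented_filtration_measurable FA.
have mA' := natural_filtration_measurable nA'.
have [mW _ _ _ indep] := brownian_W.
have mI : measurable (increment W s t @^-1` B).
  rewrite -[X in measurable X]setTI; apply: measurable_funB => //; apply: mW.
    by case/andP: st => s0 /ltW; exact: le_trans.
  by case/andP: st.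
have PE C : measurable C -> P (A `&` C) = P (A' `&` C).
  move=> mC.
  have le_P X Y : measurable X -> measurable Y -> P.-negligible (X `\` Y) ->
      P X <= P Y.
    move=> mX mY nXY.
    have mXY := measurableD mX mY.
    rewrite -(setUIDK X Y) measureU//; last 2 first.
      exact: measurableI.
      by apply/seteqP; split => // w [[_ Yw] [_]].
    rewrite (measure_negligible mXY nXY) adde0 le_measure ?inE//.
    exact: measurableI.
  apply/eqP; rewrite eq_le; apply/andP; split; apply: le_P;
    try exact: measurableI.
    by apply: negligibleS AA' => w [[Aw Cw] nA]; left; split => // h; exact: nA.
  by apply: negligibleS AA' => w [[Aw Cw] nA]; right; split => // h; exact: nA.
rewrite PE// indep// -(setIT A) -(setIT A') PE//.
Qed.

End brownian_filtration.

(** * Exponential martingales of step functions *)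

Section exponential_martingale.
Context d (T : measurableType d) (R : realType) (P : probability T R).
Variable W : R -> T -> R.
Hypothesis complete_P : measure_is_complete P.
Hypothesis brownian_W : standard_brownian_motion P W.
Local Open Scope ereal_scope.

Local Notation TF s :=
  (g_sigma_algebraType (past_events W s `|` P.-negligible)).
Local Notation "'adapted' s f" :=
  (measurable_fun (setT : set (TF s)) (f : TF s -> R))
  (at level 10, s at level 9, f at level 9).

Lemma adapted_preimage s (f : T -> R) (B : set R) : adapted s f ->
  measurable B -> augmented_filtration P W s (f @^-1` B).
Proof.
move=> af mB; have := af measurableT B mB; by rewrite setTI.
Qed.

Lemma adapted_measurable s (f : T -> R) : adapted s f -> measurable_fun setT f.
Proof.
move=> af _ B mB; rewrite setTI.
exact: (augmented_filtration_measurable complete_P brownian_W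
  (adapted_preimage af mB)).
Qed.

Lemma adaptedS s t (f : T -> R) : (s <= t)%R -> adapted s f -> adapted t f.
Proof.
move=> st af _ B mB; rewrite setTI.
exact: (augmented_filtrationS st (adapted_preimage af mB)).
Qed.

Lemma brownian_adapted r s : (0 <= r <= s)%R -> adapted s (W r).
Proof.
move=> rs _ B mB; rewrite setTI; apply: sub_gen_smallest; left.
by exists r, B.
Qed.

(** By independence the integral factors, and the second factor is [1] by the
    Gaussian moment generating function. *)
Lemma integral_exp_increment a s t (f : T -> R) : (0 <= s < t)%R ->
  adapted s f -> (forall w, (0 <= f w)%R) ->
  \int[P]_w (f w * expR (a * increment W s t w - a ^+ 2 * (t - s) / 2))%:E =
  \int[P]_w (f w)%:E.
Proof.
move=> st af f0; have mf := adapted_measurable af.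
have [s0 st'] := andP st.
have [mW _ _ lawW _] := brownian_W.
have mI : measurable_fun setT (increment W s t).
  by apply: measurable_funB => //; apply: mW => //; apply: le_trans (ltW st').
pose h (y : R) := expR (a * y - a ^+ 2 * (t - s) / 2).
have mh : measurable_fun setT h.
  apply: measurableT_comp => //; apply: measurable_funB => //.
have h0 y : (0 <= h y)%R by exact: expR_ge0.
rewrite (integralM_indep mf mI mh)//; last first.
  move=> A B mA mB.
  exact: increment_indep st (adapted_preimage af mA) mB.
suff -> : \int[P]_w (h (increment W s t w))%:E = 1 by rewrite mule1.
have mI' : measurable_fun setT (increment W s t : T -> measurableTypeR R).
  exact: mI.
pose I : {mfun T >-> measurableTypeR R} := HB.pack (increment W s t)
  (isMeasurableFun.Build _ _ _ _ _ mI').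
transitivity (\int[distribution P I]_y (h y)%:E).
  by rewrite ge0_integral_distribution//; exact/measurable_EFinP.
transitivity (\int[normal_prob 0 (Num.sqrt (t - s))]_y (h y)%:E).
  by apply: eq_measure_integral => A mA _; exact: lawW.
transitivity (\int[normal_prob 0 (Num.sqrt (t - s))]_y
    ((expR (- (a ^+ 2 * (t - s) / 2)))%:E * (expR (a * y))%:E)).
  by apply: eq_integral => y _; rewrite -EFinM -expRD addrC.
have ts0 : (0 < t - s)%R by rewrite subr_gt0.
rewrite ge0_integralZl_EFin ?expR_ge0//.
  rewrite normal_prob_mgf ?gt_eqF ?sqrtr_gt0// sqr_sqrtr ?ltW//.
  by rewrite -EFinM -expRD addNr expR0.
apply/measurable_EFinP/measurableT_comp => //; exact: measurable_funM.
Qed.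

Variables (c u : nat -> R).
Hypothesis u0 : (0 <= u 0%N)%R.
Hypothesis ltu : forall j, (u j < u j.+1)%R.

Definition grid_sum k (w : T) : R :=
  \sum_(0 <= j < k) c j * increment W (u j) (u j.+1) w.

Definition grid_variance k : R :=
  \sum_(0 <= j < k) c j ^+ 2 * (u j.+1 - u j).

Definition exp_martingale a k (w : T) : R :=
  expR (a * grid_sum k w - a ^+ 2 * grid_variance k / 2).

Let leu i j : (i <= j)%N -> (u i <= u j)%R.
Proof.
by move=> ij; apply: (homo_leq (@lexx _ _) (@le_trans _ _)) ij => n; exact: ltW.
Qed.

Let u_ge0 j : (0 <= u j)%R.
Proof. exact: le_trans u0 (leu _). Qed.

Lemma exp_martingale_adapted a k : adapted (u k) (exp_martingale a k).
Proof.
apply: measurableT_comp => //; apply: measurable_funB => //.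
apply: measurable_funM => //.
elim: k => [|k ih].
  rewrite (_ : grid_sum 0 = cst 0%R); first exact: measurable_cst.
  by apply/funext => w; rewrite /grid_sum big_geq.
rewrite /grid_sum; under eq_fun do rewrite big_nat_recr//=.
apply: measurable_funD; first exact: adaptedS (ltW (ltu k)) ih.
apply: measurable_funM => //; apply: measurable_funB.
  by apply: brownian_adapted; rewrite u_ge0 lexx.
by apply: brownian_adapted; rewrite u_ge0 ltW.
Qed.

Lemma exp_martingaleS a k w : exp_martingale a k.+1 w =
  (exp_martingale a k w * expR (a * c k * increment W (u k) (u k.+1) w
     - (a * c k) ^+ 2 * (u k.+1 - u k) / 2))%R.
Proof.
rewrite /exp_martingale -expRD; congr expR.
by rewrite /grid_sum /grid_variance !big_nat_recr//=; field.
Qed.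

Lemma exp_martingale_integral a i k (A : set T) : (i <= k)%N ->
  augmented_filtration P W (u i) A ->
  \int[P]_(w in A) (exp_martingale a k w)%:E =
  \int[P]_(w in A) (exp_martingale a i w)%:E.
Proof.
elim: k => [|k ih]; first by rewrite leqn0 => /eqP ->.
rewrite leq_eqVlt => /predU1P[->//|ik] FA; rewrite -ih//.
pose f w := (\1_A w * exp_martingale a k w)%R.
have af : adapted (u k) f.
  apply: measurable_funM; last exact: exp_martingale_adapted.
  apply: measurable_indic; exact: augmented_filtrationS (leu _) _ FA.
have f0 w : (0 <= f w)%R by rewrite mulr_ge0// expR_ge0.
have := integral_exp_increment (a * c k) _ af f0.
move=> /(_ (u k.+1)); rewrite u_ge0 ltu => /(_ isT) E.
rewrite !(integral_mkcond A); transitivity (\int[P]_w (f w)%:E); last first.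
  apply: eq_integral => w _; rewrite patchE /f indicE.
  by case: (w \in A); rewrite ?mul1r ?mul0r.
rewrite -E; apply: eq_integral => w _; rewrite patchE /f indicE.
by case: (w \in A); rewrite ?mul0r// mul1r exp_martingaleS.
Qed.

Lemma exp_martingale0 a w : exp_martingale a 0 w = 1%R.
Proof.
rewrite /exp_martingale /grid_sum /grid_variance !big_geq//.
by rewrite !mulr0 mul0r subrr expR0.
Qed.

(** Stopping only at every [q]-th time of the grid allows the grid to be refined
    while the values of the stopping time stay the same. *)
Lemma exp_martingale_stopped a (E : nat -> set T) (q K : nat) :
  (forall k, augmented_filtration P W (u (k * q)%N) (E k)) ->
  (forall k, E k `<=` E k.+1) ->
  \sum_(0 <= k < K)
    \int[P]_(w in seqD E k) (exp_martingale a (k * q)%N w)%:E <= 1.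
Proof.
move=> FE ndE.
pose Y k (w : T) := (exp_martingale a (k * q)%N w)%:E.
have mE k : measurable (E k).
  exact: augmented_filtration_measurable (FE k).
apply: le_trans (@discrete_optional_stopping _ T R P E Y K mE ndE _ _ _) _.
- move=> k; apply/measurable_EFinP; apply: adapted_measurable.
  exact: exp_martingale_adapted.
- by move=> k w; rewrite lee_fin expR_ge0.
- move=> k; rewrite /Y (@exp_martingale_integral a (k * q)%N)//.
    by rewrite leq_mul2r leqnSn orbT.
  rewrite -setTD; apply: sigma_algebraCD; exact: FE.
rewrite /Y mul0n; under eq_integral do rewrite exp_martingale0.
by rewrite integral_cst// mul1e probability_le1.
Qed.

End exponential_martingale.

(** * Approximating 1 / (1 - u) by step functions on uniform grids *)

Section grid.
Context (R : realType).
Variable t : R.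
Hypothesis t01 : 0 <= t < 1.

Definition grid (N j : nat) : R := t + (1 - t) * (j%:R / N%:R).

Let t0 : 0 <= t. Proof. by case/andP: t01. Qed.
Let t1 : 0 < 1 - t. Proof. by rewrite subr_gt0; case/andP: t01. Qed.

Lemma grid0 N : grid N 0 = t.
Proof. by rewrite /grid mul0r mulr0 addr0. Qed.

Lemma grid_refine N q k : (0 < q)%N -> grid (N * q) (k * q) = grid N k.
Proof.
move=> q0; rewrite /grid !natrM -mulf_div divff ?mulr1//.
by rewrite pnatr_eq0 -lt0n.
Qed.

Lemma gridS N j : grid N j.+1 - grid N j = (1 - t) / N%:R.
Proof. by rewrite /grid -[in j.+1%:R]addn1 natrD; ring. Qed.

Lemma ltr_gridS N j : (0 < N)%N -> grid N j < grid N j.+1.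
Proof. by move=> N0; rewrite -subr_gt0 gridS divr_gt0// ltr0n. Qed.

Lemma ler_grid N i j : (i <= j)%N -> grid N i <= grid N j.
Proof.
move=> ij; rewrite /grid lerD2l ler_pM2l// ler_wpM2r ?invr_ge0 ?ler_nat//.
Qed.

Lemma grid_ge N j : t <= grid N j.
Proof. by rewrite -{1}(grid0 N) ler_grid. Qed.

Lemma grid_ge0 N j : 0 <= grid N j.
Proof. exact: le_trans t0 (grid_ge _ _). Qed.

Lemma grid_lt1 N j : (0 < N)%N -> (grid N j < 1) = (j < N)%N.
Proof.
move=> N0; rewrite /grid -ltrBrDl gtr_pMr// ltr_pdivrMr ?ltr0n// mul1r.
by rewrite ltr_nat.
Qed.

Lemma gridN N : (0 < N)%N -> grid N N = 1.
Proof.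
by move=> N0; rewrite /grid divff ?pnatr_eq0 -?lt0n// mulr1 addrC subrK.
Qed.

(** [1 / (1 - u)] is nondecreasing, so its left-end Riemann sums for the integral
    of the square stay below the integral; on each cell this is the inequality
    between [(y - x) / (1 - x)^2] and [(y - x) / ((1 - x) (1 - y))]. *)
Lemma grid_variance_le N k : (k < N)%N ->
  grid_variance (fun j => (1 - grid N j)^-1) (grid N) k <=
    (1 - grid N k)^-1 - (1 - t)^-1.
Proof.
move=> kN; have N0 : (0 < N)%N by exact: leq_ltn_trans kN.
elim: k kN => [|k ih] kN.
  by rewrite /grid_variance big_geq// grid0 subrr.
have := ih (ltnW kN); rewrite /grid_variance big_nat_recr//= => {}ih.
have ltk := ltr_gridS k N0.
have lt1 : grid N k.+1 < 1 by rewrite grid_lt1.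
set x := grid N k in ltk ih *; set y := grid N k.+1 in lt1 ltk *.
have x1 : 0 < 1 - x by lra.
have y1 : 0 < 1 - y by lra.
suff : (1 - x)^-1 ^+ 2 * (y - x) <= (1 - y)^-1 - (1 - x)^-1 by lra.
have -> : (1 - y)^-1 - (1 - x)^-1 = (1 - x)^-1 * (1 - y)^-1 * (y - x).
  by field; rewrite !gt_eqF.
rewrite ler_pM2r ?subr_gt0// expr2 ler_pM2l ?invr_gt0//.
by rewrite lef_pV2 ?posrE//; lra.
Qed.

Definition grid_steps (N k : nat) : seq (R * (R * R)) :=
  [seq ((1 - grid N j)^-1, (grid N j, grid N j.+1)) | j <- index_iota 0 k].

Lemma step_on_grid N k : step_on t (grid N k) (grid_steps N k).
Proof.
apply/allP => _ /mapP[j /[!mem_index_iota] jk ->] /=.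
by rewrite grid_ge !ler_grid// (andP jk).2.
Qed.

Lemma step_integral_grid d (T : measurableType d) (W : R -> T -> R) N k w :
  step_integral W (grid_steps N k) w =
  grid_sum W (fun j => (1 - grid N j)^-1) (grid N) k w.
Proof. by rewrite /step_integral /grid_sum big_map. Qed.

Lemma step_fun_grid N k i v : (0 < N)%N -> (i < k)%N ->
  grid N i < v <= grid N i.+1 ->
  step_fun (grid_steps N k) v = (1 - grid N i)^-1.
Proof.
move=> N0 ik iv; rewrite /step_fun big_map (bigD1_seq i) ?iota_uniq//=; last first.
  by rewrite mem_index_iota.
rewrite indicE mem_set/= ?in_itv//= mulr1 big1_seq ?addr0// => j /andP[ji _].
rewrite indicE memNset ?mulr0//= in_itv/=.
move: iv => /andP[iv vi] /andP[jv vj].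
case: (ltngtP j i) ji => // ji _.
  by have := lt_le_trans iv (le_trans vj (ler_grid N ji)); rewrite ltxx.
by have := lt_le_trans jv (le_trans vi (ler_grid N ji)); rewrite ltxx.
Qed.

Lemma grid_cell N k v : t < v <= grid N k ->
  exists2 i, (i < k)%N & grid N i < v <= grid N i.+1.
Proof.
elim: k => [|k ih] /andP[tv vk].
  by have := lt_le_trans tv vk; rewrite grid0 ltxx.
have [vk'|kv] := leP v (grid N k).
  by have [|i ik iv] := ih _; [rewrite tv|exists i => //; exact: ltnW].
by exists k => //; rewrite kv.
Qed.

(** On a cell the difference of the two values of [1 / (1 - u)] is at most the
    mesh over [(1 - s)^2], where [s = grid N k]; of the squared mesh only one
    factor [1 / N] is kept. *)
Lemma step_fun_error N k v : (k < N)%N -> t < v <= grid N k ->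
  (step_fun (grid_steps N k) v - (1 - v)^-1) ^+ 2 <=
    (1 - grid N k) ^- 4 / N%:R.
Proof.
move=> kN tv; have N0 : (0 < N)%N by exact: leq_ltn_trans kN.
have [i ik /andP[iv vi]] := grid_cell tv.
rewrite (@step_fun_grid _ _ i)// ?iv//.
have NR : (1 : R) <= N%:R by rewrite ler1n.
have s1 : 0 < 1 - grid N k by rewrite subr_gt0 grid_lt1.
have vs : v <= grid N k by case/andP: tv.
have d1 := gridS N i.
set x := grid N i in iv d1 *; set y := grid N i.+1 in vi d1 *.
set s := grid N k in s1 vs *.
have x1 : 0 < 1 - x by lra.
have v1 : 0 < 1 - v by lra.
have -> : (1 - x)^-1 - (1 - v)^-1 = - ((1 - x)^-1 * (1 - v)^-1 * (v - x)).
  by field; rewrite !gt_eqF.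
have N1 : 0 < N%:R^-1 :> R by rewrite invr_gt0 ltr0n.
have N1' : N%:R^-1 <= 1 :> R by rewrite invf_le1// ltr0n.
have vx : v - x <= N%:R^-1.
  apply: le_trans (_ : y - x <= _); first by lra.
  by rewrite d1 ler_piMl ?(ltW N1)// gerBl.
rewrite sqrrN exprMn; apply: ler_pM; rewrite ?sqr_ge0//.
  rewrite -exprVn (_ : 4%N = (2 * 2)%N)// exprM lerXn2r ?nnegrE ?sqr_ge0//.
    by rewrite mulr_ge0 ?invr_ge0 ?(ltW v1) ?(ltW x1).
  rewrite expr2; apply: ler_pM; rewrite ?invr_ge0 ?(ltW v1) ?(ltW x1)//.
    by rewrite lef_pV2 ?posrE//; lra.
  by rewrite lef_pV2 ?posrE//; lra.
rewrite expr2; nra.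
Qed.

Lemma measurable_step_fun phi :
  measurable_fun [set: R] (step_fun phi : R -> R).
Proof.
elim: phi => [|i phi ih].
  rewrite (_ : step_fun _ = cst 0); first exact: measurable_cst.
  by apply/funext => u; rewrite /step_fun big_nil.
rewrite /step_fun; under eq_fun do rewrite big_cons.
apply: measurable_funD => //; apply: measurable_funM => //.
Qed.

Lemma grid_steps_cvg N k : (k < N)%N ->
  (\int[lebesgue_measure]_(u in `[t, grid N k])
     ((step_fun (grid_steps (N * n.+1) (k * n.+1)) u - (1 - u)^-1) ^+ 2)%R%:E)%E
  @[n --> \oo] --> 0%E.
Proof.
move=> kN; have N0 : (0 < N)%N by exact: leq_ltn_trans kN.
set s := grid N k; set M := (1 - s) ^- 4.
have s1 : 0 < 1 - s by rewrite subr_gt0 grid_lt1.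
have M0 : 0 <= M by rewrite invr_ge0 exprn_ge0// ltW.
have mV : measurable_fun `]t, s] (fun u : R => (1 - u)^-1).
  have mpow : measurable_fun `]t, s] (fun u : R => (1 - u) `^ (-1)).
    apply: (@measurableT_comp _ _ _ _ _ _ (fun x : R => x `^ (-1))).
      exact: measurable_powR.
    exact: measurable_funB.
  apply: eq_measurable_fun mpow => u; rewrite inE/= in_itv/= => /andP[_ us].
  by rewrite powR_inv1//; lra.
have mf n : measurable_fun `]t, s] (fun u =>
    ((step_fun (grid_steps (N * n.+1) (k * n.+1)) u - (1 - u)^-1) ^+ 2)%R%:E).
  apply/measurable_EFinP; apply: measurable_funX; apply: measurable_funB => //.
  apply: measurable_funTS; exact: measurable_step_fun.
apply: (@squeeze_cvge _ _ _ _ (cst 0%E) _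
  (fun n => M%:E * (harmonic n)%:E)%E _ 0%E).
- near=> n; apply/andP; split.
    by apply: integral_ge0 => u _; rewrite lee_fin sqr_ge0.
  (* The cells are open on the left, so the step function is 0 at t itself. *)
  rewrite -integral_itv_obnd_cbnd//.
  apply: (@le_trans _ _ (\int[lebesgue_measure]_(u in `]t, s])
      (cst (M * harmonic n)%:E) u)%E).
    apply: ge0_le_integral => //.
    - by move=> u _; rewrite lee_fin sqr_ge0.
    - exact: mf.
    - move=> u /=; rewrite in_itv/= => us; rewrite lee_fin.
      have := @step_fun_error (N * n.+1) (k * n.+1) u.
      rewrite grid_refine// => /(_ _ us) h; apply: le_trans (h _) _.
        by rewrite ltn_mul2r.
      rewrite ler_wpM2l// /harmonic lef_pV2 ?posrE ?ltr0n ?muln_gt0 ?N0//.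
      by rewrite ler_nat leq_pmull.
  rewrite integral_cst//= lebesgue_measure_itv/= lte_fin.
  have Mh : 0 <= M * n.+1%:R^-1 by rewrite mulr_ge0// invr_ge0.
  case: ifPn => _; last by rewrite mule0 lee_fin.
  rewrite -EFinB -EFinM lee_fin ler_piMr//.
  by case/andP: t01; lra.
- exact: cvg_cst.
- rewrite -[X in _ --> X](mule0 M%:E).
  by apply: cvgeZl => //; exact: cvge_harmonic.
Unshelve. all: by end_near. Qed.

End grid.

(** * The Wiener integral of 1 / (1 - u) *)

Section bridge_integral.
Context d (T : measurableType d) (R : realType) (P : probability T R).
Variable W : R -> T -> R.
Hypothesis complete_P : measure_is_complete P.
Hypothesis brownian_W : standard_brownian_motion P W.
Variable t : R.
Hypothesis t01 : 0 <= t < 1.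
Local Open Scope ereal_scope.

Let J N n k := grid_sum W (fun j => (1 - grid t (N * n.+1) j)^-1)%R
  (grid t (N * n.+1)) (k * n.+1).

Let kernel (u : R) : R := ((1 - u)^-1)%R.

Lemma measurable_brownian_grid_sum c N k :
  measurable_fun setT (grid_sum W c (grid t N) k).
Proof.
have [mW _ _ _ _] := brownian_W.
elim: k => [|k ih].
  rewrite (_ : grid_sum _ _ _ _ = cst 0%R); first exact: measurable_cst.
  by apply/funext => w; rewrite /grid_sum big_geq.
rewrite /grid_sum; under eq_fun do rewrite big_nat_recr//=.
apply: measurable_funD => //; apply: measurable_funM => //.
by apply: measurable_funB; apply: mW; exact: grid_ge0.
Qed.

Lemma grid_sum_L2 N k (I : T -> R) : (k < N)%N ->
  wiener_integral P W kernel t (grid t N k) I ->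
  \int[P]_w ((J N n k w - I w) ^+ 2)%R%:E @[n --> \oo] --> 0.
Proof.
move=> kN [_ /(_ (fun n => grid_steps t (N * n.+1) (k * n.+1)))] H.
have {}H := H _ (grid_steps_cvg t01 kN).
apply: cvg_trans (H _); last first.
  by move=> n; rewrite -(@grid_refine _ t N n.+1)//; exact: step_on_grid.
rewrite unlock; apply: near_eq_cvg; near=> n.
by apply: eq_integral => w _; rewrite step_integral_grid.
Unshelve. all: by end_near. Qed.

Lemma cvg0_eventually_le (e : nat -> \bar R) (r : R) : (0 < r)%R ->
  e n @[n --> \oo] --> 0 -> exists M, forall n, (M <= n)%N -> e n <= r%:E.
Proof.
move=> r0 e0; have [M _ HM] := e0 _ (@nbhs_open_ereal_lt _ 0%R (fun=> r) r0).
by exists M => n Mn; apply/ltW/HM.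
Qed.

(** Both integrals are L^2 limits of the same step integrals. *)
Lemma bridge_integral_unique N k (I I' : T -> R) : (k < N)%N ->
  wiener_integral P W kernel t (grid t N k) I ->
  wiener_integral P W kernel t (grid t N k) I' ->
  {ae P, forall w, I w = I' w}.
Proof.
move=> kN wI wI'; have [mI _] := wI; have [mI' _] := wI'.
have msq (f g : T -> R) : measurable_fun setT f -> measurable_fun setT g ->
    measurable_fun setT (fun w => ((f w - g w) ^+ 2)%R%:E).
  by move=> mf mg; apply/measurable_EFinP/measurable_funX/measurable_funB.
have sq0 (f g : T -> R) w : 0 <= ((f w - g w) ^+ 2)%R%:E by rewrite lee_fin sqr_ge0.
have II'0 : \int[P]_w ((I w - I' w) ^+ 2)%R%:E = 0.
  apply/eqP; rewrite eq_le; apply/andP; split; last by apply: integral_ge0.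
  apply/lee_addgt0Pr => e e0; rewrite add0e.
  have e40 : (0 < e / 4)%R by rewrite divr_gt0.
  have [M HM] := cvg0_eventually_le e40 (grid_sum_L2 kN wI).
  have [M' HM'] := cvg0_eventually_le e40 (grid_sum_L2 kN wI').
  pose n := maxn M M'.
  have mJ : measurable_fun setT (J N n k) by exact: measurable_brownian_grid_sum.
  apply: (@le_trans _ _ (\int[P]_w (2%:E * (((J N n k w - I w) ^+ 2)%R%:E
      + ((J N n k w - I' w) ^+ 2)%R%:E)))).
    apply: ge0_le_integral => //.
    - exact: msq.
    - by apply: emeasurable_funM => //; apply: emeasurable_funD; exact: msq.
    - move=> w _; rewrite -EFinD -EFinM lee_fin.
      have := sqr_ge0 (J N n k w - I w + (J N n k w - I' w)).
      by rewrite !expr2; lra.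
  rewrite ge0_integralZl_EFin//; last 2 first.
    - by move=> w _; rewrite adde_ge0.
    - by apply: emeasurable_funD; exact: msq.
  rewrite ge0_integralD//; try exact: msq.
  apply: (@le_trans _ _ (2%:E * ((e / 4)%:E + (e / 4)%:E))).
    rewrite lee_wpmul2l ?lee_fin// leeD//; first by apply: HM; exact: leq_maxl.
    by apply: HM'; exact: leq_maxr.
  by rewrite -EFinD -EFinM lee_fin; lra.
have : \int[P]_w `|((I w - I' w) ^+ 2)%R%:E| = 0.
  by under eq_integral do rewrite gee0_abs//.
move=> /(ae_eq_integral_abs P measurableT (msq _ _ mI mI')).1.
apply: filterS => w /(_ Logic.I) [] /eqP; rewrite sqrf_eq0 subr_eq0 => /eqP//.
Qed.

(** For the step integrals [J N n k] the sum is at most [1] by optional stopping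
    in discrete time, their compensators being below the one used here.  Capping
    the exponent at [C] makes the error at most [exp C * |a|] times the L^1
    distance of [I k] and [J N n k], and that distance is at most [e] plus
    [1 / e] times the squared L^2 distance, thus at most [2 e] for large [n]. *)
Lemma stopped_exponential_le1 a C N (E : nat -> set T) (I : nat -> T -> R) :
  (0 < N)%N ->
  (forall k, augmented_filtration P W (grid t N k) (E k)) ->
  (forall k, E k `<=` E k.+1) ->
  (forall k, (k < N)%N -> wiener_integral P W kernel t (grid t N k) (I k)) ->
  \sum_(0 <= k < N) \int[P]_(w in seqD E k)
     (expR (Num.min (a * I k w
        - a ^+ 2 * ((1 - grid t N k)^-1 - (1 - t)^-1) / 2) C))%:E <= 1.
Proof.
move=> N0 FE ndE wI.
have mE k : measurable (E k).
  exact: augmented_filtration_measurable (FE k).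
have mD k : measurable (seqD E k).
  by case: k => [|k] //=; exact: measurableD.
pose M := (expR C * `|a|)%R.
have M0 : (0 <= M)%R by rewrite mulr_ge0// expR_ge0.
suff H e : (0 < e)%R -> \sum_(0 <= k < N) \int[P]_(w in seqD E k)
     (expR (Num.min (a * I k w
        - a ^+ 2 * ((1 - grid t N k)^-1 - (1 - t)^-1) / 2) C))%:E
     <= 1 + (N%:R * (M * (e + e)))%:E.
  apply/lee_addgt0Pr => e e0.
  pose D : R := (N%:R * (M * 2) + 1)%R.
  have D0 : (0 < D)%R by rewrite ltr_wpDl// mulr_ge0// mulr_ge0.
  apply: le_trans (H (e / D)%R _) _; first by rewrite divr_gt0.
  rewrite leeD2l// lee_fin.
  rewrite (_ : (N%:R * _)%R = (e * ((N%:R * (M * 2)) / D))%R); last by ring.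
  by rewrite ler_piMr ?(ltW e0)// ler_pdivrMr// mul1r lerDl.
move=> e0.
have [n Hn] : exists n, forall k, (k < N)%N ->
    \int[P]_w ((J N n k w - I k w) ^+ 2)%R%:E <= (e ^+ 2)%:E.
  have e20 : (0 < e ^+ 2)%R by rewrite exprn_gt0.
  have /choice[M_ HM_] : forall k, exists M', (k < N)%N -> forall n, (M' <= n)%N ->
      \int[P]_w ((J N n k w - I k w) ^+ 2)%R%:E <= (e ^+ 2)%:E.
    move=> k.
    have [kN|kN] := boolP (k < N)%N; last by exists 0%N.
    have [M' HM'] := cvg0_eventually_le e20 (grid_sum_L2 kN (wI k kN)).
    by exists M'.
  exists (\max_(k < N) M_ k)%N => k kN; apply: HM_ => //.
  exact: (@leq_bigmax _ (fun k : 'I_N => M_ k) (Ordinal kN)).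
pose c j := ((1 - grid t (N * n.+1) j)^-1)%R.
pose u := grid t (N * n.+1).
have Nn0 : (0 < N * n.+1)%N by rewrite muln_gt0 N0.
have mJ k : measurable_fun setT (J N n k) by exact: measurable_brownian_grid_sum.
have stopped := @exp_martingale_stopped _ _ _ _ W complete_P brownian_W c u
  (grid_ge0 t01 _ _) (fun j => ltr_gridS t01 j Nn0) a E n.+1 N.
have {}stopped := stopped (fun k => _) ndE.
have {}stopped : \sum_(0 <= k < N) \int[P]_(w in seqD E k)
    (exp_martingale W c u a (k * n.+1) w)%:E <= 1.
  by apply: stopped => k; rewrite /u grid_refine.
have msq k : (k < N)%N ->
    measurable_fun setT (fun w => ((J N n k w - I k w) ^+ 2)%R%:E).
  move=> kN; apply/measurable_EFinP/measurable_funX/measurable_funB => //.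
  by have [] := wI k kN.
apply: (@le_trans _ _ (\sum_(0 <= k < N) (\int[P]_(w in seqD E k)
    (exp_martingale W c u a (k * n.+1) w)%:E + (M * (e + e))%:E))).
  rewrite big_seq [leRHS]big_seq; apply: lee_sum => k.
  rewrite mem_index_iota => /andP[_ kN].
  have mI : measurable_fun setT (I k) by have [] := wI k kN.
  have mexp : measurable_fun setT (exp_martingale W c u a (k * n.+1)).
    apply: measurableT_comp => //; apply: measurable_funB => //.
    by apply: measurable_funM => //; exact: mJ.
  have mY : measurable_fun (seqD E k)
      (fun w => (exp_martingale W c u a (k * n.+1) w)%:E).
    exact/measurable_funTS/measurable_EFinP.
  have merr : measurable_fun setT
      (fun w => (M * (e + (J N n k w - I k w) ^+ 2 / e))%:E).
    apply/measurable_EFinP; apply: measurable_funM => //.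
    apply: measurable_funD => //; apply: measurable_funM => //.
    by apply: measurable_funX; apply: measurable_funB.
  have err0 w : 0 <= (M * (e + (J N n k w - I k w) ^+ 2 / e))%:E.
    by rewrite lee_fin mulr_ge0// addr_ge0 ?(ltW e0)// divr_ge0 ?sqr_ge0 ?(ltW e0).
  apply: (@le_trans _ _ (\int[P]_(w in seqD E k)
      ((exp_martingale W c u a (k * n.+1) w)%:E
       + (M * (e + (J N n k w - I k w) ^+ 2 / e))%:E))).
    apply: ge0_le_integral => //.
    - apply/measurable_funTS/measurable_EFinP/measurableT_comp => //.
      apply: measurable_minr => //; apply: measurable_funB => //.
      exact: measurable_funM.
    - apply: emeasurable_funD => //; exact: measurable_funTS.
    - move=> w _; rewrite -EFinD lee_fin.
      apply: le_trans (expR_min_le _ (a * J N n k w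
        - a ^+ 2 * ((1 - grid t N k)^-1 - (1 - t)^-1) / 2) _) _.
      apply: lerD.
        rewrite ler_expR lerD2l lerN2 ler_pM2r ?invr_gt0// ler_wpM2l ?sqr_ge0//.
        have := @grid_variance_le _ t t01 (N * n.+1) (k * n.+1).
        by rewrite grid_refine//; apply; rewrite ltn_mul2r.
      rewrite opprB addrA subrK -mulrBr normrM mulrA -/M ler_wpM2l//.
      set x := (J N n k w - I k w)%R; rewrite distrC -/x.
      rewrite -(ler_pM2l e0) mulrDr mulrCA divff ?gt_eqF// mulr1.
      rewrite -[(x ^+ 2)%R]real_normK ?num_real//.
      have := normr_ge0 x; rewrite !expr2; nra.
  rewrite ge0_integralD//; last 2 first.
    - by move=> w _; rewrite lee_fin expR_ge0.
    - exact: measurable_funTS.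
  rewrite leeD2l//.
  apply: (@le_trans _ _ (\int[P]_w (M * (e + (J N n k w - I k w) ^+ 2 / e))%:E)).
    by apply: ge0_subset_integral => //.
  under eq_integral do rewrite EFinM EFinD mulrC [(e^-1 * _)%:E]EFinM.
  rewrite ge0_integralZl_EFin//; last 2 first.
    - move=> w _; rewrite -EFinM -EFinD lee_fin addr_ge0 ?(ltW e0)//.
      by rewrite mulr_ge0 ?sqr_ge0// invr_ge0 ltW.
    - apply: emeasurable_funD => //; apply: emeasurable_funM => //; exact: msq.
  rewrite [leRHS]EFinM lee_wpmul2l ?lee_fin//.
  rewrite ge0_integralD//; last 3 first.
    - by move=> w _; rewrite lee_fin ltW.
    - by move=> w _; rewrite -EFinM lee_fin mulr_ge0 ?sqr_ge0// invr_ge0 ltW.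
    - by apply: emeasurable_funM => //; exact: msq.
  rewrite EFinD; apply: leeD.
    rewrite integral_cst// -[leRHS]mule1 lee_wpmul2l ?lee_fin ?(ltW e0)//.
    exact: probability_le1.
  rewrite ge0_integralZl_EFin//; last 3 first.
    - by move=> w _; rewrite lee_fin sqr_ge0.
    - exact: msq.
    - by rewrite invr_ge0 ltW.
  apply: le_trans (_ : e^-1%:E * (e ^+ 2)%:E <= _).
    by rewrite lee_wpmul2l ?lee_fin ?invr_ge0 ?(ltW e0)//; exact: Hn.
  by rewrite -EFinM lee_fin expr2 mulrA mulVf ?gt_eqF// mul1r.
rewrite big_split/= leeD//.
rewrite sumEFin lee_fin sumr_const_nat subn0.
by rewrite [leRHS]mulr_natl lexx.
Qed.

End bridge_integral.

(** * Rounding a time up to the grid *)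

Section grid_rounding.
Context (R : realType).
Variable t : R.
Hypothesis t01 : 0 <= t < 1.

Let t1 : 0 < 1 - t. Proof. by rewrite subr_gt0; case/andP: t01. Qed.

(** The index of the first grid point at or after [s]; rounding up keeps stopping
    times adapted. *)
Definition grid_index (N : nat) (s : R) : nat :=
  `|Num.ceil ((s - t) / (1 - t) * N%:R)|%N.

Lemma grid_index_le N s k : (0 < N)%N -> t <= s ->
  (grid_index N s <= k)%N = (s <= grid t N k).
Proof.
move=> N0 ts; rewrite /grid_index -lez_nat gez0_abs; last first.
  rewrite ceil_ge0 (@lt_le_trans _ _ 0)//.
  by rewrite mulr_ge0// divr_ge0 ?(ltW t1)// subr_ge0.
rewrite ceil_le_int /grid -lerBlDl [_%:~R]/(k%:R).
by rewrite -ler_pdivlMr ?ltr0n// ler_pdivrMr// mulrC.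
Qed.

Lemma grid_index_leN N s : (0 < N)%N -> t <= s <= 1 -> (grid_index N s <= N)%N.
Proof. by move=> N0 /andP[ts s1]; rewrite grid_index_le// gridN. Qed.

Lemma grid_index1 N : (0 < N)%N -> grid_index N 1 = N.
Proof.
by move=> N0; rewrite /grid_index divff ?gt_eqF// mul1r -[_%:R]/(N%:~R) intrKceil.
Qed.

Lemma grid_round_error N s : (0 < N)%N -> t <= s ->
  s <= grid t N (grid_index N s) <= s + (1 - t) / N%:R.
Proof.
move=> N0 ts; rewrite -grid_index_le// leqnn/=.
case E : (grid_index N s) => [|k].
  by rewrite grid0 (le_trans ts)// lerDl divr_ge0 ?(ltW t1).
have : ~~ (grid_index N s <= k)%N by rewrite E ltnn.
rewrite grid_index_le// -ltNge => /ltW ks.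
by rewrite -lerBlDr -(gridS t N k) opprB addrC subrK.
Qed.

Lemma grid_round_cvg s : t <= s ->
  grid t m.+1 (grid_index m.+1 s) @[m --> \oo] --> s.
Proof.
move=> ts; apply: (@squeeze_cvgr _ _ _ _ (cst s)
  (fun m => s + (1 - t) * harmonic m)).
- by near=> m; exact: grid_round_error.
- exact: cvg_cst.
- rewrite -[X in _ --> X]addr0; apply: cvgD; first exact: cvg_cst.
  rewrite -[X in _ --> X](mulr0 (1 - t)); apply: cvgMr; exact: cvg_harmonic.
Unshelve. all: by end_near. Qed.

Lemma grid_index_eventually_lt s : t <= s < 1 ->
  \forall m \near \oo, (grid_index m.+1 s < m.+1)%N.
Proof.
move=> /andP[ts s1].
have := grid_round_cvg ts => /cvgr_lt/(_ 1 s1).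
by apply: filterS => m; rewrite grid_lt1.
Qed.

Lemma path_cvg (f : R -> R) (s_ : nat -> R) s :
  {within `[t, 1[, continuous f} -> t <= s < 1 ->
  (\forall m \near \oo, t <= s_ m < 1) -> s_ m @[m --> \oo] --> s ->
  f (s_ m) @[m --> \oo] --> f s.
Proof.
move=> cf st near_s ss.
have sin : (`[t, 1[%classic : set R) s by rewrite /= in_itv.
have h : s_ m @[m --> \oo] --> within `[t, 1[ (nbhs s).
  move=> A wA; have := ss _ wA; apply: filterS2 near_s => m sm; apply.
  by rewrite /= in_itv.
move/(subspace_cvgP _ sin) : h => h.
exact: cvg_comp h (cf s).
Qed.

Lemma grid_path_cvg (f : R -> R) s : {within `[t, 1[, continuous f} -> t <= s < 1 ->
  f (grid t m.+1 (grid_index m.+1 s)) @[m --> \oo] --> f s.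
Proof.
move=> cf st; have [ts s1] := andP st.
apply: path_cvg => //; last exact: grid_round_cvg.
have := grid_index_eventually_lt st; apply: filterS => m im.
by rewrite grid_ge// grid_lt1.
Qed.

End grid_rounding.

(** * The bridge at a stopping time *)

Section stopped_bridge.
Context d (T : measurableType d) (R : realType) (P : probability T R).
Variables (W : R -> T -> R) (t : R) (X : R -> R -> T -> R).
Hypothesis complete_P : measure_is_complete P.
Hypothesis brownian_W : standard_brownian_motion P W.
Hypothesis t01 : 0 <= t < 1.
Hypothesis bridge_X : forall x, brownian_bridge P W t x (X x).

Let t1 : 0 < 1 - t. Proof. by rewrite subr_gt0; case/andP: t01. Qed.

(** At the countably many grid points this is uniqueness of the stochastic
    integral; path continuity extends it to all times before [1], and at time [1]
    both bridges vanish. *)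
Lemma bridge_shift x y : {ae P, forall w, forall s, t <= s <= 1 ->
  X y s w = X x s w + (y - x) * (1 - s) / (1 - t)}.
Proof.
have [_ cx Ix x1] := bridge_X x; have [_ cy Iy y1] := bridge_X y.
have on_grid : {ae P, forall w, forall m k : nat, (k < m.+1)%N ->
    X y (grid t m.+1 k) w = X x (grid t m.+1 k) w
      + (y - x) * (1 - grid t m.+1 k) / (1 - t)}.
  apply: ae_foralln => m; apply: ae_foralln => k.
  have [km|km] := boolP (k < m.+1)%N; last by apply: aeW => w.
  have sk : t <= grid t m.+1 k < 1 by rewrite grid_ge// grid_lt1.
  have [I wI XI] := Ix _ sk; have [I' wI' XI'] := Iy _ sk.
  have II' := bridge_integral_unique brownian_W t01 km wI wI'.
  apply: filterS3 XI XI' II' => w -> -> -> _.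
  by field; exact: lt0r_neq0.
apply: filterS3 (filterI cx cy) (filterI x1 y1) on_grid => w [cxw cyw] [x1w y1w].
move=> gw s /andP[ts]; rewrite le_eqVlt => /predU1P[->|s1].
  by rewrite x1w y1w subrr mulr0 mul0r addr0.
have st : t <= s < 1 by rewrite ts.
have lx := grid_path_cvg t01 cxw st; have ly := grid_path_cvg t01 cyw st.
have lg := grid_round_cvg t01 ts.
apply: (cvg_unique _ ly) => //.
have : X x (grid t m.+1 (grid_index t m.+1 s)) w
    + (y - x) * (1 - grid t m.+1 (grid_index t m.+1 s)) / (1 - t) @[m --> \oo]
    --> X x s w + (y - x) * (1 - s) / (1 - t).
  apply: cvgD => //; apply: cvgMl; apply: cvgMr.
  by apply: cvgB => //; exact: cvg_cst.
apply: cvg_trans; apply: near_eq_cvg.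
have := grid_index_eventually_lt t01 st; apply: filterS => m im.
by rewrite gw.
Qed.

Variable tau : T -> R.
Hypothesis adm_tau : admissible_time P W t tau.

Let tau_ge w : t <= t + tau w.
Proof. by rewrite lerDl; have [/(_ w)/andP[]] := adm_tau. Qed.

Let tau_le w : t + tau w <= 1.
Proof. by rewrite -lerBrDl; have [/(_ w)/andP[]] := adm_tau. Qed.

Definition stopped_index N w : nat := grid_index t N (t + tau w).

Definition grid_stopped_by N k : set T := [set w | t + tau w <= grid t N k].

Lemma grid_stopped_byF N k :
  augmented_filtration P W (grid t N k) (grid_stopped_by N k).
Proof. by have [_] := adm_tau; apply; exact: grid_ge. Qed.

Lemma grid_stopped_by_measurable N k : measurable (grid_stopped_by N k).
Proof.
exact (augmented_filtration_measurable complete_P brownian_W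
  (@grid_stopped_byF N k)).
Qed.

Lemma grid_stopped_byS N k : grid_stopped_by N k `<=` grid_stopped_by N k.+1.
Proof. by move=> w /= h; apply: le_trans h _; exact: ler_grid. Qed.

Lemma stopped_indexE N k : (0 < N)%N ->
  seqD (grid_stopped_by N) k = [set w | stopped_index N w = k].
Proof.
move=> N0; apply/seteqP; split => w; case: k => [|k] /=.
- by rewrite /grid_stopped_by /= -grid_index_le// leqn0 => /eqP.
- rewrite /grid_stopped_by /= => -[]; rewrite -!grid_index_le//.
  by move=> h1 /negP; rewrite -ltnNge => h2; apply/eqP; rewrite eqn_leq h1.
- by rewrite /grid_stopped_by /= -grid_index_le// => <-.
- move=> iE; split;
    rewrite /grid_stopped_by /= -grid_index_le// -/(stopped_index N w) iE//.
  by rewrite ltnn.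
Qed.

Lemma stopped_index_measurable N k : (0 < N)%N ->
  measurable [set w | stopped_index N w = k].
Proof.
move=> N0; rewrite -stopped_indexE//; case: k => [|k] /=.
  exact: grid_stopped_by_measurable.
by apply: measurableD; exact: grid_stopped_by_measurable.
Qed.

Lemma bridge_measurable x s : t <= s <= 1 -> measurable_fun setT (X x s).
Proof.
move=> ts _ B mB; rewrite setTI; have [+ _ _ _] := bridge_X x.
move=> /(_ s ts B mB); exact: augmented_filtration_measurable.
Qed.

Definition rounded_bridge x N w := X x (grid t N (stopped_index N w)) w.

Lemma rounded_bridge_measurable x N : (0 < N)%N ->
  measurable_fun setT (rounded_bridge x N).
Proof.
move=> N0 _ B mB; rewrite setTI.
have -> : rounded_bridge x N @^-1` B = \bigcup_(k in [set k | (k <= N)%N])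
    ([set w | stopped_index N w = k] `&` (X x (grid t N k) @^-1` B)).
  apply/seteqP; split => w /=.
    move=> Bw; exists (stopped_index N w) => //=.
    by apply: grid_index_leN => //; rewrite tau_ge tau_le.
  by move=> [k _ [<-]].
apply: bigcup_measurable => k /= kN; apply: measurableI.
  exact: stopped_index_measurable.
rewrite -[X in measurable X]setTI; apply: bridge_measurable => //.
by rewrite grid_ge//= -(gridN t N0) ler_grid.
Qed.

Definition stopped_bridge x w := X x (t + tau w) w.

(** Almost sure continuity before time [1] suffices: when [t + tau w = 1],
    rounding up does not move the time. *)
Lemma rounded_bridge_cvg x : {ae P, forall w,
  rounded_bridge x m.+1 w @[m --> \oo] --> stopped_bridge x w}.
Proof.
have [_ cx _ _] := bridge_X x.
apply: filterS cx => w cxw.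
have := tau_le w; rewrite le_eqVlt => /predU1P[E|s1]; last first.
  by apply: (@grid_path_cvg _ t t01 (X x ^~ w)) => //; rewrite tau_ge.
rewrite /rounded_bridge /stopped_bridge /stopped_index E.
under eq_fun do rewrite grid_index1// gridN//.
exact: cvg_cst.
Qed.

(** The stopped bridge is an almost sure limit of measurable functions, hence
    measurable for a complete measure. *)
Lemma stopped_bridge_measurable x : measurable_fun setT (stopped_bridge x).
Proof.
apply/measurable_EFinP.
apply: (@ae_measurable_fun _ _ _ P complete_P _
  (fun w => limn_esup (fun m => (rounded_bridge x m.+1 w)%:E))).
  apply: filterS (rounded_bridge_cvg x) => w cw _.
  have /cvg_limn_einf_sup[_ ->//] :
    (rounded_bridge x m.+1 w)%:E @[m --> \oo] --> (stopped_bridge x w)%:E.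
  by apply: cvg_EFin => //; near=> m.
apply: measurable_fun_limn_esup => m.
by apply/measurable_EFinP; exact: rounded_bridge_measurable.
Unshelve. all: by end_near. Qed.

End stopped_bridge.

(** * Comparing payoffs, and the upper bound *)

Section value_bounds.
Context d (T : measurableType d) (R : realType) (P : probability T R).
Variables (W : R -> T -> R) (t : R) (X : R -> R -> T -> R).
Hypothesis complete_P : measure_is_complete P.
Hypothesis brownian_W : standard_brownian_motion P W.
Hypothesis t01 : 0 <= t < 1.
Hypothesis bridge_X : forall x, brownian_bridge P W t x (X x).
Variable tau : T -> R.
Hypothesis adm_tau : admissible_time P W t tau.

Let t1 : 0 < 1 - t. Proof. by rewrite subr_gt0; case/andP: t01. Qed.

Let tau_ge w : t <= t + tau w.
Proof. by rewrite lerDl; have [/(_ w)/andP[]] := adm_tau. Qed.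

Let tau_le w : t + tau w <= 1.
Proof. by rewrite -lerBrDl; have [/(_ w)/andP[]] := adm_tau. Qed.

Local Notation stopped x := (stopped_bridge t X tau x).

Let mexp x : measurable_fun setT (fun w => (expR (stopped x w))%:E).
Proof.
apply/measurable_EFinP; apply: measurableT_comp => //.
exact: (stopped_bridge_measurable complete_P brownian_W t01 bridge_X adm_tau).
Qed.

Lemma stopped_bridge_down x y : y <= x ->
  ((expR (y - x))%:E * \int[P]_w (expR (stopped x w))%:E
    <= \int[P]_w (expR (stopped y w))%:E)%E.
Proof.
move=> yx; rewrite -ge0_integralZl_EFin ?expR_ge0//.
apply: ae_ge0_le_integral => //.
- by apply: emeasurable_funM => //; exact: mexp.
- apply: filterS (bridge_shift brownian_W t01 bridge_X x y) => w sw _.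
  rewrite -EFinM -expRD lee_fin ler_expR /stopped_bridge sw ?tau_ge ?tau_le//.
  rewrite addrC lerD2l -mulrA.
  have : (1 - (t + tau w)) / (1 - t) <= 1.
    by rewrite ler_pdivrMr// mul1r lerB.
  nra.
Qed.

Lemma stopped_bridge_up x y : x <= y ->
  (\int[P]_w (expR (stopped x w))%:E <= \int[P]_w (expR (stopped y w))%:E)%E.
Proof.
move=> xy; apply: ae_ge0_le_integral => //; try exact: mexp.
apply: filterS (bridge_shift brownian_W t01 bridge_X x y) => w sw _.
rewrite lee_fin ler_expR /stopped_bridge sw ?tau_ge ?tau_le//.
by rewrite lerDl divr_ge0 ?(ltW t1)// mulr_ge0 ?subr_ge0.
Qed.

(** The logarithm of the exponential martingale with parameter [2 (1 - t)],
    written as a function of the position [v] at time [s] of the bridge started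
    at [2 - t]; see [log_barrier_bridge]. *)
Definition log_barrier (s v : R) : R :=
  2 * ((1 - t) * v / (1 - s) - (1 - t) ^+ 2 / (1 - s) - 1).

Lemma log_barrier_bridge s I : s < 1 ->
  log_barrier s ((1 - s) * ((2 - t) / (1 - t) + I)) =
  2 * (1 - t) * I
    - (2 * (1 - t)) ^+ 2 * ((1 - s)^-1 - (1 - t)^-1) / 2.
Proof.
move=> s1; have s10 : 0 < 1 - s by rewrite subr_gt0.
by rewrite /log_barrier; field; rewrite !gt_eqF.
Qed.

(** With [2 y = log_barrier s v], the exponent [v] equals [2 - t] plus
    [(1 - s) / (1 - t) * (y + 1) - 1]. *)
Lemma payoff_le_barrier s v : t <= s < 1 ->
  expR v <= expR (2 - t) * (2^-1 * (1 + expR (log_barrier s v))).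
Proof.
move=> /andP[ts s1]; have s10 : 0 < 1 - s by rewrite subr_gt0.
set y := (1 - t) * v / (1 - s) - (1 - t) ^+ 2 / (1 - s) - 1.
have -> : v = (2 - t) + ((1 - s) / (1 - t) * (y + 1) - 1).
  by rewrite /y; field; rewrite !gt_eqF.
rewrite expRD ler_pM2l ?expR_gt0//.
have -> : (2 - t) + ((1 - s) / (1 - t) * (y + 1) - 1) = v.
  by rewrite /y; field; rewrite !gt_eqF.
apply: expR_interpolation_le; rewrite divr_ge0 ?(ltW s10) ?(ltW t1)//=.
by rewrite ler_pdivrMr// mul1r lerB.
Qed.

(** The exponential martingale at the rounded stopping time, capped at [exp m] and
    set to [0] where that time is [1]. *)
Let capped_barrier x m w : R :=
  let N := m.+1 in let k := stopped_index t tau N w in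
  if (k < N)%N then
    expR (Num.min (log_barrier (grid t N k) (rounded_bridge t X tau x N w)) m%:R)
  else 0.

Let capped_barrierE x m w : (capped_barrier x m w)%:E =
  (\sum_(k < m.+1)
    ((fun w => (expR (Num.min (log_barrier (grid t m.+1 k)
       (X x (grid t m.+1 k) w)) m%:R))%:E)
     \_ (seqD (grid_stopped_by t tau m.+1) k)) w)%E.
Proof.
rewrite /capped_barrier; set k0 := stopped_index t tau m.+1 w.
have outside k : k != k0 -> w \notin seqD (grid_stopped_by t tau m.+1) k.
  move=> kk0; rewrite (stopped_indexE t01 adm_tau)// notin_setE /=.
  by apply/eqP; rewrite eq_sym.
case: ifPn => k0N; last first.
  rewrite big1// => k _; rewrite patchE (negbTE (outside k _))//.
  by apply: contraNneq k0N => <-.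
rewrite (bigD1 (Ordinal k0N))//= big1 ?adde0; last first.
  by move=> k kk0; rewrite patchE (negbTE (outside k kk0)).
rewrite patchE mem_set//.
by rewrite (stopped_indexE t01 adm_tau).
Qed.

Let mbarrier x s : t <= s <= 1 -> forall m : nat,
  measurable_fun setT (fun w => (expR (Num.min (log_barrier s (X x s w)) m%:R))%:E).
Proof.
move=> ts m; apply/measurable_EFinP/measurableT_comp => //.
apply: measurable_minr => //; apply: measurable_funM => //.
have mX := bridge_measurable complete_P brownian_W bridge_X x ts.
apply: measurable_funB => //; apply: measurable_funB => //.
by apply: measurable_funM => //; apply: measurable_funM.
Qed.

Let grid_in m k : (k < m.+1)%N -> t <= grid t m.+1 k < 1.
Proof. by move=> km; rewrite grid_ge// grid_lt1. Qed.

Let mseqD m k : measurable (seqD (grid_stopped_by t tau m.+1) k).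
Proof.
rewrite (stopped_indexE t01 adm_tau)//.
exact: (stopped_index_measurable complete_P brownian_W t01 adm_tau).
Qed.

Let mterm x m (k : 'I_m.+1) : measurable_fun setT
  ((fun w => (expR (Num.min (log_barrier (grid t m.+1 k)
     (X x (grid t m.+1 k) w)) m%:R))%:E)
   \_ (seqD (grid_stopped_by t tau m.+1) k)).
Proof.
apply/(measurable_restrictT _ _).1; first exact: mseqD.
apply: measurable_funTS; apply: mbarrier.
by have /andP[-> /ltW] := grid_in (ltn_ord k).
Qed.

Let measurable_capped_barrier x m :
  measurable_fun setT (fun w => (capped_barrier x m w)%:E).
Proof.
under eq_fun do rewrite capped_barrierE.
by apply: emeasurable_sum => k; exact: mterm.
Qed.

Let capped_barrier_integral m : (\int[P]_w (capped_barrier (2 - t) m w)%:E <= 1)%E.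
Proof.
have [_ _ IX _] := bridge_X (2 - t).
have /choice[I HI] : forall k, exists I : T -> R, (k < m.+1)%N ->
    wiener_integral P W (fun u => (1 - u)^-1) t (grid t m.+1 k) I /\
    {ae P, forall w, X (2 - t) (grid t m.+1 k) w =
      (1 - grid t m.+1 k) * ((2 - t) / (1 - t) + I w)}.
  move=> k; have [km|km] := boolP (k < m.+1)%N; last by exists (cst 0).
  by have [I wI XI] := IX _ (grid_in km); exists I.
pose E := grid_stopped_by t tau m.+1.
have FE k : augmented_filtration P W (grid t m.+1 k) (E k).
  exact: grid_stopped_byF.
have EE k : E k `<=` E k.+1 by exact: grid_stopped_byS.
have := stopped_exponential_le1 complete_P brownian_W t01
  (2 * (1 - t)) m%:R (ltn0Sn m) FE EE (fun k km => (HI k km).1).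
apply: le_trans.
under eq_integral do rewrite capped_barrierE.
rewrite ge0_integral_sum//; last first.
  by move=> k w _; apply: erestrict_ge0 => v _; rewrite lee_fin expR_ge0.
rewrite big_mkord; apply: lee_sum => k _; rewrite -integral_mkcond.
have km := ltn_ord k; have [wI XI] := HI k km.
have [_ s1] := andP (grid_in km).
rewrite le_eqVlt; apply/orP; left; apply/eqP.
apply: ge0_ae_eq_integral => //.
- apply: measurable_funTS; apply: mbarrier.
  by have /andP[-> /ltW] := grid_in km.
- apply/measurable_funTS/measurable_EFinP/measurableT_comp => //.
  apply: measurable_minr => //; apply: measurable_funB => //.
  by apply: measurable_funM => //; have [] := wI.
- by apply: filterS XI => w -> _; rewrite log_barrier_bridge.
Qed.

(** The exponents converge, hence stay below the growing cap [m] eventually. *)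
Let capped_barrier_cvg x : {ae P, forall w, t + tau w < 1 ->
  capped_barrier x m w @[m --> \oo]
    --> expR (log_barrier (t + tau w) (stopped x w))}.
Proof.
apply: filterS (rounded_bridge_cvg t01 bridge_X adm_tau x) => w Xw s1.
have st : t <= t + tau w < 1 by rewrite tau_ge.
have sw := grid_round_cvg t01 (tau_ge w).
pose l m := log_barrier (grid t m.+1 (stopped_index t tau m.+1 w))
  (rounded_bridge t X tau x m.+1 w).
have lw : l m @[m --> \oo] --> log_barrier (t + tau w) (stopped x w).
  have s10 : 1 - (t + tau w) != 0 by rewrite gt_eqF// subr_gt0.
  have inv : (1 - grid t m.+1 (stopped_index t tau m.+1 w))^-1 @[m --> \oo]
      --> (1 - (t + tau w))^-1.
    by apply: cvgV => //; apply: cvgB => //; exact: cvg_cst.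
  apply: cvgMr; apply: cvgB; last exact: cvg_cst.
  apply: cvgB; apply: cvgM => //; last exact: cvg_cst.
  exact: cvgMr.
have : expR (l m) @[m --> \oo] --> expR (log_barrier (t + tau w) (stopped x w)).
  by apply: cvg_comp lw _; exact: continuous_expR.
apply: cvg_trans; apply: near_eq_cvg.
have lbound : \forall m \near \oo, l m <= log_barrier (t + tau w) (stopped x w) + 1.
  by apply: (cvgr_le _ lw); rewrite ltrDl.
near=> m; rewrite /capped_barrier ifT; last first.
  by near: m; exact: grid_index_eventually_lt.
rewrite -/(l m) min_l//.
apply: le_trans (_ : log_barrier (t + tau w) (stopped x w) + 1 <= _).
  by near: m.
near: m; exact: nbhs_infty_ger.
Unshelve. all: by end_near. Qed.

(** By Fatou's lemma the lower limit [g] of the capped martingales has integral at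
    most [1], and the payoff is almost surely at most [exp (2 - t)] times the mean
    of [1] and [g]; when [t + tau w = 1] this is [1 <= exp (2 - t) / 2]. *)
Lemma stopped_bridge_bound :
  (\int[P]_w (expR (stopped (2 - t) w))%:E <= (expR (2 - t))%:E)%E.
Proof.
pose g w := limn_einf (fun m => (capped_barrier (2 - t) m w)%:E).
have capped_barrier_ge0 m w : 0 <= capped_barrier (2 - t) m w.
  by rewrite /capped_barrier; case: ifP => // _; exact: expR_ge0.
have g0 w : (0 <= g w)%E.
  rewrite /g limn_einf_lim; apply: lime_ge; first exact: is_cvg_einfs.
  by apply: nearW => n; apply: le_ereal_inf_tmp => _ [k _ <-]; rewrite lee_fin.
have mg : measurable_fun setT g.
  rewrite /g (_ : (fun w => _) = fun w =>
    (- limn_esup (fun m => - (capped_barrier (2 - t) m w)%:E))%E).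
    apply: measurableT_comp => //; apply: measurable_fun_limn_esup => m.
    by apply: measurableT_comp => //; exact: measurable_capped_barrier.
  apply/funext => w.
  by rewrite (limn_esupN (fun m => (capped_barrier (2 - t) m w)%:E)) oppeK.
have gi : (\int[P]_w g w <= 1)%E.
  apply: le_trans (fatou P measurableT (measurable_capped_barrier (2 - t)) _) _.
    by move=> m w _; rewrite lee_fin.
  rewrite limn_einf_lim; apply: lime_le; first exact: is_cvg_einfs.
  apply: nearW => n; apply: ereal_inf_le.
  exists (\int[P]_w (capped_barrier (2 - t) n w)%:E)%E.
    by exists n => /=.
  exact: capped_barrier_integral.
apply: (@le_trans _ _ (\int[P]_w ((expR (2 - t) / 2)%:E * (1 + g w)))%E).
  apply: ae_ge0_le_integral => //.
  - by move=> w _; rewrite mule_ge0 ?lee_fin ?divr_ge0 ?expR_ge0// adde_ge0.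
  - by apply: emeasurable_funM => //; exact: emeasurable_funD.
  have [_ _ _ X1] := bridge_X (2 - t).
  apply: filterS2 X1 (capped_barrier_cvg (2 - t)) => w X1w hw _.
  have := tau_le w; rewrite le_eqVlt => /predU1P[E|s1].
    rewrite /stopped_bridge E X1w expR0.
    apply: (@le_trans _ _ (expR (2 - t) / 2)%:E); last first.
      by rewrite -[leLHS]mule1 lee_wpmul2l ?lee_fin ?divr_ge0 ?expR_ge0// leeDl.
    rewrite lee_fin ler_pdivlMr// mul1r.
    by apply: le_trans (expR_ge1Dx _); move: t1; lra.
  rewrite (_ : g w =
      (expR (log_barrier (t + tau w) (stopped (2 - t) w)))%:E); last first.
    have : (capped_barrier (2 - t) m w)%:E @[m --> \oo] -->
        (expR (log_barrier (t + tau w) (stopped (2 - t) w)))%:E.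
      by apply: cvg_EFin; [near=> m|exact: hw].
    by case/cvg_limn_einf_sup.
  rewrite -EFinD -EFinM lee_fin -mulrA; apply: payoff_le_barrier.
  by rewrite tau_ge.
rewrite ge0_integralZl_EFin ?divr_ge0 ?expR_ge0//; last 2 first.
- by move=> w _; rewrite adde_ge0.
- exact: emeasurable_funD.
rewrite ge0_integralD// integral_cst// mul1e.
rewrite [leRHS](_ : _ = (expR (2 - t) / 2)%:E * (1 + 1))%E; last first.
  by rewrite -EFinD -EFinM; congr EFin; field.
rewrite lee_wpmul2l ?lee_fin ?divr_ge0 ?expR_ge0// leeD// probability_le1//.
Unshelve. all: by end_near. Qed.

End value_bounds.

(** * The continuation region at a fixed time *)

Section continuation_section.
Context d (T : measurableType d) (R : realType) (P : probability T R).
Variables (W : R -> T -> R) (t : R) (X : R -> R -> R -> T -> R).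
Hypothesis complete_P : measure_is_complete P.
Hypothesis brownian_W : standard_brownian_motion P W.
Hypothesis t01 : 0 <= t < 1.
Hypothesis bridge_X : forall x, brownian_bridge P W t x (X t x).

Definition continuation_section : set R :=
  [set x | ((expR x)%:E < value P W X t x)%E].

Let payoff tau x : \bar R :=
  (\int[P]_w (expR (stopped_bridge t (X t) tau x w))%:E)%E.

Let valueE x : value P W X t x =
  ereal_sup [set payoff tau x | tau in admissible_time P W t].
Proof.
rewrite /value; case/andP: t01 => _ ->.
by congr (ereal_sup (_ @` _)); apply/funext => tau; rewrite unlock.
Qed.

Lemma continuation_sectionP x : continuation_section x <->
  exists2 tau, admissible_time P W t tau & ((expR x)%:E < payoff tau x)%E.
Proof.
rewrite /continuation_section /= valueE; split.
  by move=> /ereal_sup_gt[_ [tau adm_tau <-] ?]; exists tau.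
move=> [tau adm_tau h]; apply: lt_le_trans h _; apply: ereal_sup_ubound.
by exists tau.
Qed.

Lemma continuation_section_down x y : y <= x ->
  continuation_section x -> continuation_section y.
Proof.
move=> yx /continuation_sectionP[tau adm_tau h]; apply/continuation_sectionP.
exists tau => //; apply: lt_le_trans
  (stopped_bridge_down complete_P brownian_W t01 bridge_X adm_tau yx).
rewrite -[ltLHS](_ : ((expR (y - x))%:E * (expR x)%:E)%E = _).
  by rewrite lte_pmul2l// lte_fin expR_gt0.
by rewrite -EFinM -expRD subrK.
Qed.

(** The stopping time that is good at [x] is at least as good to the right of [x],
    where the strict inequality survives by continuity of [exp]. *)
Lemma continuation_section_open x : continuation_section x ->
  exists2 y, x < y & continuation_section y.
Proof.
move=> /continuation_sectionP[tau adm_tau h].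
have up y : x <= y -> (payoff tau x <= payoff tau y)%E.
  exact: (stopped_bridge_up complete_P brownian_W t01 bridge_X adm_tau).
suff [y xy hy] : exists2 y, x < y & ((expR y)%:E < payoff tau x)%E.
  exists y => //; apply/continuation_sectionP; exists tau => //.
  by apply: lt_le_trans hy (up y (ltW xy)).
case: (payoff tau x) h => [r| |]//.
- rewrite lte_fin => xr; have r0 : 0 < r by apply: lt_trans xr; exact: expR_gt0.
  have {}xr : x < ln r by rewrite -ltr_expR lnK.
  exists ((x + ln r) / 2); first by rewrite midf_lt.
  by rewrite lte_fin -[ltRHS]lnK// ltr_expR midf_lt.
- by move=> _; exists (x + 1); rewrite ?ltrDl ?ltry.
Qed.

(** Waiting until time [1] pays [exp 0]. *)
Lemma continuation_section_neg x : x < 0 -> continuation_section x.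
Proof.
move=> x0; apply/continuation_sectionP; exists (cst (1 - t)).
  split => [w|s ts].
    by rewrite lexx andbT subr_ge0; case/andP: t01 => _ /ltW.
  have [s1|s1] := leP (t + (1 - t)) s.
    rewrite (_ : [set w | _] = setT).
      exact: (@measurableT _ (g_sigma_algebraType _)).
    by apply/seteqP; split => // w _ /=.
  rewrite (_ : [set w | _] = set0).
    exact: (@measurable0 _ (g_sigma_algebraType _)).
  by apply/seteqP; split => // w /=; rewrite leNgt s1.
have [_ _ _ X1] := bridge_X x.
have t1 : t <= (1 : R) <= 1.
  by apply/andP; split => //; case/andP: t01 => _ /ltW.
have mX := bridge_measurable complete_P brownian_W bridge_X x t1.
rewrite /payoff (@ge0_ae_eq_integral _ _ _ P _ _ (cst 1%E))//.
- rewrite integral_cst// mul1e [X in (_ < X)%E](@probability_setT _ _ _ P).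
  by rewrite lte_fin -expR0 ltr_expR.
- apply/measurable_EFinP/measurableT_comp => //.
  by rewrite /stopped_bridge /= addrC subrK.
- by apply: filterS X1 => w X1w _; rewrite /stopped_bridge /= addrC subrK X1w expR0.
Qed.

Lemma continuation_section_ub x : continuation_section x -> x <= 2 - t.
Proof.
move=> Sx; rewrite leNgt; apply/negP => /ltW xt.
have /continuation_sectionP[tau adm_tau] := continuation_section_down xt Sx.
have := stopped_bridge_bound complete_P brownian_W t01 bridge_X adm_tau.
by move=> /le_lt_trans /[apply]; rewrite ltxx.
Qed.

Lemma has_sup_continuation_section : has_sup continuation_section.
Proof.
split; first by exists (-1); apply: continuation_section_neg; rewrite ltrN10.
by exists (2 - t) => x; exact: continuation_section_ub.
Qed.

Lemma continuation_sectionE x :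
  continuation_section x <-> x < sup continuation_section.
Proof.
split=> [/continuation_section_open[y xy Sy]|].
  apply: lt_le_trans xy _; apply: ub_le_sup => //.
  by have [] := has_sup_continuation_section.
move=> /(sup_gt (proj1 has_sup_continuation_section))[y Sy /ltW xy].
exact: continuation_section_down Sy.
Qed.

Lemma sup_continuation_section_ge0 : 0 <= sup continuation_section.
Proof.
rewrite leNgt; apply/negP => /[dup] sup0 /continuation_section_neg.
by move/continuation_sectionE; rewrite ltxx.
Qed.

End continuation_section.

(** * The stopping boundary *)

Theorem proposition3p3 (d : measure_display) (T : measurableType d)
    (R : realType) (P : probability T R) (W : R -> T -> R)
    (X : R -> R -> R -> T -> R)
    (complete_P : measure_is_complete P)
    (brownian_W : standard_brownian_motion P W)
    (bridge_X : forall t x : R, 0 <= t < 1 ->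
       brownian_bridge P W t x (X t x)) :
  exists b : R -> R,
    (forall t : R, 0 <= t <= 1 -> 0 <= b t) /\
    continuation_region P W X =
      [set z : R * R | 0 <= z.1 < 1 /\ z.2 < b z.1].
Proof.
have bridge t (t01 : 0 <= t < 1) x := bridge_X t x t01.
exists (fun t => if t < 1 then sup (continuation_section P W t X) else 0).
split=> [t /andP[t0 _]|].
  case: ifPn => // t1.
  apply: (sup_continuation_section_ge0 complete_P brownian_W _ (bridge t _));
    by rewrite t0 t1.
apply/seteqP; split => -[t x] /=.
  move=> [/andP[t0 t1]]; rewrite le_eqVlt in t1.
  case/predU1P : t1 => [->|t1]; first by rewrite /value !ltxx.
  have t01 : 0 <= t < 1 by rewrite t0.
  rewrite t01 t1.
  by move=> /(continuation_sectionE complete_P brownian_W t01 (bridge t t01)).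
move=> [t01]; have /andP[t0 t1] := t01; rewrite t1.
move=> /(continuation_sectionE complete_P brownian_W t01 (bridge t t01)) Sx.
by split => //; apply/andP; split => //; exact: ltW.
Qed.
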